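(* Let $\mathbb{B}$ be a separable Banach space ordered by a cone $\mathcal{K}$, let $X\subseteq\mathbb{B}$ be p-convex, and let $\Phi$ be a strongly order preserving semiflow on $X$. If $C$ is dense in $B$, then $C$ is prevalent in $B$, i.e. $B\setminus C$ is shy in $\mathbb{B}$.
   Context: An order cone $\mathcal{K}\subset\mathbb{B}$ is a closed convex cone with $\mathcal{K}\cap(-\mathcal{K})=\{0\}$ and $\mathcal{K}\neq\{0\}$. Write $x\le y$ iff $y-x\in\mathcal{K}$; $x<y$ iff $x\le y$ and $x\ne y$; for sets, $A\le A'$ means $a\le a'$ for all $a\in A$, $a'\in A'$. A subset $A\subseteq\mathbb{B}$ is p-convex if $x,y\in A$ and $x<y$ imply $tx+(1-t)y\in A$ for $0<t<1$. A semiflow on $X$ is a continuous map $\Phi:[0,\infty)\times X\to X$, $(t,x)\mapsto\Phi_t(x)$, with $\Phi_0=\mathrm{id}$ and $\Phi_t\circ\Phi_s=\Phi_{t+s}$. It is monotone if $x\le y$ implies $\Phi_t(x)\le\Phi_t(y)$ for $t\ge0$. It is strongly order preserving (SOP) if it is monotone and whenever $x<y$ there are open subsets $U,V$ of $X$ with $x\in U$, $y\in V$ and $t_0\ge0$ such that $\Phi_{t_0}(U)\le\Phi_{t_0}(V)$. $O(x)=\{\Phi_t(x):t\ge0\}$ is the orbit, $\omega(x)\subseteq X$ the omega limit set, $E$ the set of equilibria (points fixed by all $\Phi_t$). Define - $B=\{x\in X: O(x)\text{ has compact closure in }X\}$, - $C=\{x\in X:\omega(x)=\{e\}\text{ for some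 }e\in E\}$. ''$C$ is dense in $B$'' means that $C\cap B$ is dense in $B$. A set $W\subseteq\mathbb{B}$ is shy if there is a nontrivial compactly supported Borel measure $\mu$ on $\mathbb{B}$ with $\mu(W+x)=0$ for every $x\in\mathbb{B}$ (for a set that is not Borel, $\mu(S)=0$ means that $S$ is contained in a Borel set of $\mu$-measure zero). Given $A\subseteq\mathbb{B}$, $W$ is prevalent in $A$ if $A\setminus W$ is shy. *)

(* Defs.v *)
From mathcomp Require Import all_boot all_order all_algebra.
From mathcomp Require Import all_classical all_reals all_analysis.

Set Implicit Arguments.
Unset Strict Implicit.
Unset Printing Implicit Defensive.

Import Order.TTheory GRing.Theory Num.Theory.
Import numFieldNormedType.Exports.

Local Open Scope classical_set_scope.
Local Open Scope ring_scope.

Definition separable (T : topologicalType) : Prop :=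
  exists2 D : set T, countable D & dense D.

Section OrderCone.
Context {R : realType} {V : normedModType R}.

Record order_cone (K : set V) : Prop := OrderCone {
  order_cone_closed : closed K;
  order_cone_convex : convex_set (K : set (convex_lmodType V));
  order_cone_scale : forall (r : R) (x : V), 0 <= r -> K x -> K (r *: x);
  order_cone_pointed : K `&` [set - x | x in K] = [set 0];
  order_cone_nontrivial : K <> [set 0] }.

Definition cone_le (K : set V) (x y : V) : Prop := K (y - x).

Definition cone_lt (K : set V) (x y : V) : Prop := cone_le K x y /\ x <> y.

Definition cone_le_set (K A A' : set V) : Prop :=
  forall a a', A a -> A' a' -> cone_le K a a'.

Definition p_convex (K A : set V) : Prop :=
  forall x y, A x -> A y -> cone_lt K x y ->
  forall t : R, 0 < t < 1 -> A (t *: x + (1 - t) *: y).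

End OrderCone.

(* A semiflow on [X] is encoded by a function defined on all of [R * V]; its
   values at negative times and outside of [X] are junk, and nothing below
   depends on them. *)
Section Semiflow.
Context {R : realType} {V : normedModType R}.
Implicit Types (K X : set V) (Phi : R -> V -> V).

Record semiflow X Phi : Prop := Semiflow {
  semiflow_stable : forall t x, 0 <= t -> X x -> X (Phi t x);
  semiflow_continuous :
    {within [set p : R * V | 0 <= p.1 /\ X p.2],
      continuous (fun p : R * V => Phi p.1 p.2)};
  semiflow_0 : forall x, X x -> Phi 0 x = x;
  semiflow_add : forall t s x, 0 <= t -> 0 <= s -> X x ->
    Phi t (Phi s x) = Phi (t + s) x }.

Definition monotone_semiflow K X Phi : Prop :=
  forall x y, X x -> X y -> cone_le K x y ->
  forall t, 0 <= t -> cone_le K (Phi t x) (Phi t y).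

Definition open_in X (U : set V) : Prop :=
  exists2 O : set V, open O & U = X `&` O.

Definition strongly_order_preserving K X Phi : Prop :=
  monotone_semiflow K X Phi /\
  forall x y, X x -> X y -> cone_lt K x y ->
  exists U W : set V, [/\ open_in X U, open_in X W, U x, W y &
    exists2 t0 : R, 0 <= t0 & cone_le_set K (Phi t0 @` U) (Phi t0 @` W)].

Definition orbit_from Phi (t : R) (x : V) : set V :=
  [set Phi s x | s in [set s : R | t <= s]].

Definition orbit Phi (x : V) : set V := orbit_from Phi 0 x.

Definition closure_in X (A : set V) : set V := X `&` closure A.

Definition omega_limit X Phi (x : V) : set V :=
  \bigcap_(t in [set t : R | 0 <= t]) closure_in X (orbit_from Phi t x).

Definition equilibria X Phi : set V :=
  [set e | X e /\ forall t, 0 <= t -> Phi t e = e].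

Definition compact_orbit_points X Phi : set V :=
  [set x | X x /\ compact (closure_in X (orbit Phi x))].

Definition convergent_points X Phi : set V :=
  [set x | X x /\
    exists2 e, equilibria X Phi e & omega_limit X Phi x = [set e]].

(* [C] need not be contained in [A]. *)
Definition dense_in (C A : set V) : Prop := A `<=` closure (C `&` A).

End Semiflow.

Section Prevalence.
Context {R : realType} {V : normedModType R}.

Local Notation borel := (g_sigma_algebraType (@open V)).

(* As usual for compactly supported measures, [mu] is finite; without this,
   the measure equal to 0 on meagre sets and to +oo on all other Borel sets of
   a compact interval would make every meagre subset of the line shy. *)
Definition shy (W : set V) : Prop :=
  exists mu : {finite_measure set borel -> \bar R},
    [/\ mu setT <> 0%E,
        exists2 Q : set V, compact Q & mu (~` Q) = 0%E &
        forall x : V, mu.-negligible [set w + x | w in W]].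

Definition prevalent_in (W A : set V) : Prop := shy (A `\` W).

End Prevalence.

(* Main.v *)
(* The witnessing measure is the uniform one on the segment [0, v], where v is a
   nonzero vector of the cone: it suffices that every line L parallel to v meets
   B \ C in a countable set. Such a line is totally ordered. If x < m < y lie in
   L and in B \ C, strong order preservation makes a whole neighbourhood of m
   eventually squeezed between x and y; density puts in it a point converging to
   some equilibrium e, so omega(x) <= e <= omega(y). On the other hand omega(x)
   has two points for x in B \ C, hence some q, p in omega(x) with not q <= p.
   This survives small perturbations of p and q, so in a separable space
   countably many pairs of balls suffice, and each pair of balls serves at most
   two points of L. *)
Require Import Defs.
From mathcomp Require Import all_boot all_order all_algebra.
From mathcomp Require Import lra.
From mathcomp Require Import all_classical all_reals all_analysis.

Set Implicit Arguments.
Unset Strict Implicit.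
Unset Printing Implicit Defensive.

Import numFieldNormedType.Exports.
Import Order.TTheory GRing.Theory Num.Theory.

Local Open Scope classical_set_scope.
Local Open Scope ring_scope.

(** * Omega limit sets of a semiflow *)

Section OmegaLimit.
Context {R : realType} {V : normedModType R}.
Implicit Types (X D : set V) (Phi : R -> V -> V).

(** Compactness of the orbit closure yields the cluster point; it is a limit point because [G]
    contains every tail of times. A general [G] allows restricting to selected late times, as one
    passes to a subsequence. *)
Lemma omega_limit_cluster X Phi x (G : set_system R) :
  semiflow X Phi -> compact_orbit_points X Phi x -> ProperFilter G ->
  (forall t, 0 <= t -> G [set s | t <= s]) ->
  exists2 b, omega_limit X Phi x b & cluster (Phi^~ x @ G) b.
Proof.
move=> flow [Xx cx] PG Goo.
have [|b [[Xb _] clb]] := cx (Phi^~ x @ G) (fmap_proper_filter _ PG).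
  rewrite nbhs_simpl; apply: (@filterS _ G _ _ _ _ (Goo 0 (lexx _))) => s /= s0.
  split; first exact: (semiflow_stable flow).
  by apply: subset_closure; exists s.
exists b => // t /= t0; split => // N Nb; apply: clb => //.
by rewrite nbhs_simpl; apply: (@filterS _ G _ _ _ _ (Goo t t0)) => s /= ts; exists s.
Qed.

Lemma omega_limit_nonempty X Phi x :
  semiflow X Phi -> compact_orbit_points X Phi x -> omega_limit X Phi x !=set0.
Proof.
move=> flow Bx.
have [|b ob _] := @omega_limit_cluster X Phi x (pinfty_nbhs R) flow Bx _.
  by move=> t _; apply: nbhs_pinfty_ge; exact: num_real.
by exists b.
Qed.

(** The orbit of [x] is near [y] at arbitrarily late [s]; continuity at [(t, y)] then puts
    [Phi (t + s) x] near [Phi t y]. *)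
Lemma omega_limit_stable X Phi x y t :
  semiflow X Phi -> X x -> 0 <= t -> omega_limit X Phi x y ->
  omega_limit X Phi x (Phi t y).
Proof.
move=> flow Xx t0 oy.
have Xy : X y by have [] := oy 0 (lexx _).
move=> r /= r0; split; first exact: (semiflow_stable flow).
move=> N Nty.
have /subspace_continuousP/(_ (t, y) (conj t0 Xy))/(_ N Nty) :=
  semiflow_continuous flow.
move=> [[/= A1 A2] [/= A1t A2y] sub].
have [_ clr] := oy r r0.
have [_ [[s /= rs <-] A2s]] := clr A2 A2y.
have s0 : 0 <= s by exact: le_trans rs.
exists (Phi (t + s) x); split; first by exists (t + s) => //=; rewrite ler_wpDl.
rewrite -(semiflow_add flow)//.
apply: (sub (t, Phi s x)) => /=; first by split=> //; exact: nbhs_singleton.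
by split=> //; exact: (semiflow_stable flow).
Qed.

(** A one-point limit set, being forward invariant, would consist of an equilibrium, and [x] would
    converge. *)
Lemma omega_limit_two_points X Phi x :
  semiflow X Phi -> compact_orbit_points X Phi x ->
  ~ convergent_points X Phi x ->
  exists a b, [/\ omega_limit X Phi x a, omega_limit X Phi x b & a <> b].
Proof.
move=> flow Bx nCx; have [a oa] := omega_limit_nonempty flow Bx.
have Xx : X x by case: Bx.
apply: contrapT => no; apply: nCx; split => //.
have single b : omega_limit X Phi x b -> b = a.
  by move=> ob; apply: contrapT => ba; apply: no; exists b, a.
exists a.
  split; first by have [] := oa 0 (lexx _).
  by move=> t t0; apply: single; exact: omega_limit_stable.
by apply/seteqP; split=> [b /single//|_ ->].
Qed.

(* [b] is a cluster point of the orbit of [y] along the late times at which the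
   orbit of [x] is close to [a]; no compactness of the orbit of [x] is needed. *)
Lemma omega_limit_compare X Phi x y a D (t1 : R) :
  semiflow X Phi -> compact_orbit_points X Phi y -> closed D -> 0 <= t1 ->
  (forall t, t1 <= t -> D (Phi t y - Phi t x)) ->
  omega_limit X Phi x a ->
  exists2 b, omega_limit X Phi y b & D (b - a).
Proof.
move=> flow By cD t10 DP oa.
pose times (p : set V * R) := [set s : R | p.2 <= s /\ p.1 (Phi s x)].
pose late := [set p : set V * R | nbhs a p.1 /\ 0 <= p.2].
have FG : Filter (filter_from late times).
  apply: filter_from_filter.
    by exists (setT, 0); split => //; exact: filterT.
  move=> [N t] [N' t'] [/= Na t0] [/= Na' t0'].
  exists (N `&` N', Num.max t t').
    by split => /=; [exact: filterI|rewrite le_max t0].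
  by move=> s [/=]; rewrite ge_max => /andP[ts t's] [Ns Ns'].
have PG : ProperFilter (filter_from late times).
  apply: filter_from_proper => -[N t] [/= Na t0].
  have [_ /(_ N Na)[_ [[s /= ts <-] Ns]]] := oa t t0.
  by exists s.
have [|b ob clb] := @omega_limit_cluster X Phi y _ flow By PG _.
  by move=> t t0; exists (setT, t) => [|s []//]; split=> //; exact: filterT.
exists b => //; rewrite (closure_id D).1// => N Nba.
have : (fun p : V * V => p.1 - p.2) @ (b, a) --> b - a.
  by apply: cvgB; [exact: cvg_fst|exact: cvg_snd].
move=> /(_ N Nba)[[/= N1 N2] [/= N1b N2a] sub].
have [] := clb (Phi^~ y @` times (N2, t1)) N1 _ N1b.
  rewrite nbhs_simpl; exists (N2, t1) => // s ts; by exists s.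
move=> _ [[s [/= t1s N2s] <-] N1s].
by exists (Phi s y - Phi s x); split; [exact: DP|exact: (sub (_, _))].
Qed.

End OmegaLimit.

(** * The cone order and squeezing between ordered orbits *)

Section Order.
Context {R : realType} {V : normedModType R}.
Context (K : set V) (Kcone : order_cone K).

Lemma order_cone0 : K 0.
Proof.
have [_ /(_ 0 erefl)[]//] : K `&` [set - x | x in K] `<=>` [set 0].
by apply/seteqP; exact: order_cone_pointed.
Qed.

Lemma order_coneD x y : K x -> K y -> K (x + y).
Proof.
(* [x + y] is twice the midpoint of [x] and [y], which convexity puts in [K]. *)
move=> Kx Ky; have h : (0 <= 2^-1 :> R) && (2^-1 <= 1 :> R).
  by rewrite invr_ge0 ler0n invf_le1 ?ler1n ?ltr0n.
pose p := Itv01 (proj1 (andP h)) (proj2 (andP h)).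
have := @order_cone_convex _ _ _ Kcone x y p.
rewrite !inE => /(_ Kx Ky) /(order_cone_scale Kcone (ler0n R 2)).
rewrite /conv/= scalerDr !scalerA mulfV ?pnatr_eq0// scale1r.
have -> : (2 : R) * unstable.onem 2^-1 = 1.
  by rewrite /unstable.onem mulrBr mulr1 mulfV ?pnatr_eq0// -[2]/(1 + 1) addrK.
by rewrite scale1r.
Qed.

Lemma cone_le_trans x y z : cone_le K x y -> cone_le K y z -> cone_le K x z.
Proof.
move=> Kxy Kyz; rewrite /cone_le.
by have := order_coneD Kxy Kyz; rewrite addrC subrKA.
Qed.

Lemma cone_le_anti x y : cone_le K x y -> cone_le K y x -> x = y.
Proof.
move=> xy yx; apply/eqP; rewrite -subr_eq0; apply/eqP.
rewrite -[_ = _]/([set 0] (x - y)) -(order_cone_pointed Kcone); split => //.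
by exists (y - x) => //; rewrite opprB.
Qed.

Lemma exists_positive : exists2 v, K v & v <> 0.
Proof.
apply: contrapT => no; apply: (order_cone_nontrivial Kcone).
apply/seteqP; split=> [v Kv|_ ->]; last exact: order_cone0.
by apply: contrapT => v0; apply: no; exists v.
Qed.

Context (X : set V) (Phi : R -> V -> V).
Hypothesis flow : semiflow X Phi.
Hypothesis sop : strongly_order_preserving K X Phi.

(** Strong order preservation orders orbits at a single time only; the comparison of limit sets
    needs all later times. *)
Lemma monotone_from x y t0 t : X x -> X y -> 0 <= t0 -> t0 <= t ->
  cone_le K (Phi t0 x) (Phi t0 y) -> cone_le K (Phi t x) (Phi t y).
Proof.
move=> Xx Xy t00 t0t le0; have tt0 : 0 <= t - t0 by rewrite subr_ge0.
rewrite -(subrK t0 t) -(semiflow_add flow tt0 t00 Xx).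
rewrite -(semiflow_add flow tt0 t00 Xy).
by apply: sop.1 => //; exact: (semiflow_stable flow).
Qed.

Lemma omega_limit_ordered x m y :
  dense_in (convergent_points X Phi) (compact_orbit_points X Phi) ->
  X x -> compact_orbit_points X Phi m -> X y ->
  cone_lt K x m -> cone_lt K m y ->
  cone_le_set K (omega_limit X Phi x) (omega_limit X Phi y).
Proof.
move=> Cdense Xx Bm Xy xm my q p oq op; have Xm := Bm.1.
have [U1 [W1 [ [G1 oG1 U1E] [G1' oG1' W1E] U1x W1m [t1 t10 le1]]]] :=
  sop.2 x m Xx Xm xm.
have [U2 [W2 [ [G2 oG2 U2E] [G2' oG2' W2E] U2m W2y [t2 t20 le2]]]] :=
  sop.2 m y Xm Xy my.
have [] := Cdense m Bm (G1' `&` G2).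
  move: W1m U2m; rewrite W1E U2E => -[_ G1'm] [_ G2m].
  by apply: filterI; exact: open_nbhs_nbhs.
move=> c [ [ [Xc [e _ oe]] Bc] [G1'c G2c]].
have W1c : W1 c by rewrite W1E.
have U2c : U2 c by rewrite U2E.
have cK := order_cone_closed Kcone.
have xc t : t1 <= t -> K (Phi t c - Phi t x).
  by move=> t1t; apply: (@monotone_from _ _ t1) => //; apply: le1;
    [exists x|exists c].
(* The orbit known to have compact closure is that of [c], so the upper bound is also written as a
   difference starting from [Phi t c], now in the closed set -K. *)
have cy t : t2 <= t -> [set z | K (- z)] (Phi t c - Phi t y).
  move=> t2t; rewrite /= opprB.
  by apply: (@monotone_from _ _ t2) => //; apply: le2; [exists c|exists y].
have cNK : closed [set z | K (- z)].
  by apply: (@closed_comp _ _ -%R K) => // z _; exact: opp_continuous.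
have [e1] := omega_limit_compare flow Bc cK t10 xc oq.
rewrite oe => -> qe.
have [e2] := omega_limit_compare flow Bc cNK t20 cy op.
rewrite oe => -> /=; rewrite opprB => ep.
exact: cone_le_trans qe ep.
Qed.

End Order.

(** * Countability of the exceptional parameters on a line *)

Lemma countable_no_triple (R : realType) (S : set R) :
  (forall s m t, S s -> S m -> S t -> s < m -> m < t -> False) -> countable S.
Proof.
move=> no; apply: finite_set_countable.
have [->|/set0P[a Sa]] := eqVneq S set0; first exact: finite_set0.
have [Sa1|] := pselect (S `<=` [set a]).
  exact: sub_finite_set (finite_set1 a).
move=> /existsNP[b /not_implyP[Sb /eqP ba]].
(* A third element would form an increasing triple with [a] and [b], in one of six orders. *)
apply: (@sub_finite_set _ _ [set a; b]); last exact: finite_set2.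
move=> c Sc; apply: contrapT => /not_orP[/eqP ca /eqP cb].
move: ba ca cb; rewrite !neq_lt => /orP[?|?] /orP[?|?] /orP[?|?];
  first [exact: (no a b c)|exact: (no a c b)|exact: (no b a c)
        |exact: (no b c a)|exact: (no c a b)|exact: (no c b a)].
Qed.

Lemma countable_chain (R : realType) (V : normedModType R) (K : set V)
    (S : set R) (Om : R -> set V) :
  Defs.separable V -> closed K ->
  (forall t, S t -> exists p q, [/\ Om t p, Om t q & ~ K (p - q)]) ->
  (forall s m t, S s -> S m -> S t -> s < m -> m < t ->
     forall q p, Om s q -> Om t p -> K (p - q)) ->
  countable S.
Proof.
move=> [D cD dD] cK two ord.
(* An index is a pair of balls with centres in [D] and a common radius 1/(n+1); [I] keeps those on
   which [p - q] always avoids [K]. *)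
pose near_pair (i : V * V * nat) p q :=
  `|i.1.1 - p| < i.2.+1%:R^-1 /\ `|i.1.2 - q| < i.2.+1%:R^-1.
pose I := (D `*` D `*` setT) `&`
  [set i : V * V * nat | forall p q, near_pair i p q -> ~ K (p - q)].
pose F i := [set t | S t /\ exists p q, [/\ Om t p, Om t q & near_pair i p q]].
have cI : countable I.
  apply: (sub_countable (subset_card_le (@subIsetl _ _ _))).
  by apply: countableX => //; exact: countableX.
(* In a triple s < m < t, a point [q] of [Om s] and a point [p] of [Om t] in the two balls would
   satisfy [K (p - q)], against the choice of [I]. *)
have cF i : I i -> countable (F i).
  move=> [_ Ki]; apply: countable_no_triple => s m t.
  move=> [Ss [_ [q [_ Oq [_ nq]]]]] [Sm _] [St [p [_ [Op _ [np _]]]]] sm mt.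
  by apply: (Ki p q) => //; exact: (ord s m t).
apply: (sub_countable _ (bigcup_countable cI cF)).
apply: subset_card_le => t St.
have [p [q [Op Oq Kpq]]] := two t St.
have : nbhs (p - q) (~` K).
  by apply: open_nbhs_nbhs; split => //; exact: closed_openC.
move=> /nbhs_ballP[e /= e0 ball_e].
(* Four distances below the radius add up in the final estimate, hence [e / 4]. *)
have [n] : exists n, 0 + n.+1%:R^-1 < e / 4 by exact/ltr_add_invr/divr_gt0.
rewrite add0r => ne.
have n0 : 0 < n.+1%:R^-1 :> R by rewrite invr_gt0.
have approx z : exists2 d, D d & `|d - z| < n.+1%:R^-1.
  have [|d [zd Dd]] := dD (ball z n.+1%:R^-1) _ (ball_open _ _).
    by exists z; exact: ballxx.
  by exists d => //; rewrite distrC; move: zd; rewrite -ball_normE.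
have [d Dd dp] := approx p; have [d' Dd' d'q] := approx q.
exists (d, d', n) => //; last by split => //; exists p, q.
split=> // p' q' [/= dp' d'q']; apply: ball_e; rewrite -ball_normE /=.
have -> : p - q - (p' - q') = (d - p') - (d - p) + ((d' - q) - (d' - q')).
  rewrite !opprB [d - p' + _]addrC subrKA [d' - q + _]addrC subrKA.
  by rewrite addrACA [RHS]addrACA [- q - _]addrC.
apply: le_lt_trans (ler_normD _ _) _.
apply: le_lt_trans (lerD (ler_normB _ _) (ler_normB _ _)) _.
move: dp' d'q' dp d'q ne n0; move: (n.+1%:R^-1) => r; lra.
Qed.

(** * Shyness from countable sections along parallel lines *)

Lemma finite_pushforward d d' (T : measurableType d) (U : measurableType d')
    (R : realType) (m : {measure set T -> \bar R}) (f : T -> U) :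
  (m setT < +oo)%E -> measurable_fun setT f ->
  exists mu : {finite_measure set U -> \bar R}, mu =1 pushforward m f.
Proof.
move=> moo mf; pose M : {measure set U -> \bar R} := pushforward m f.
have Moo : (M mf setT < +oo)%E by [].
(* Restricting to the whole space leaves the values unchanged and supplies the finite measure
   structure. *)
exists (mfrestr measurableT Moo) => A.
by rewrite -[LHS]/(pushforward m f (A `&` setT)) setIT.
Qed.

Section Line.
Context {R : realType} {V : normedModType R}.

Local Notation borel := (g_sigma_algebraType (@open V)).

Lemma borel_measurable_open (A : set V) : open A -> measurable (A : set borel).
Proof. exact: sub_gen_smallest. Qed.

Lemma borel_measurable_closed (A : set V) :
  closed A -> measurable (A : set borel).
Proof.
move=> cA; rewrite -[A]setCK; apply: measurableC; apply: borel_measurable_open.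
exact: closed_openC.
Qed.

Lemma shy_countable_lines (W : set V) (v : V) : v <> 0 ->
  (forall z, countable [set t : R | W (t *: v + z)]) -> shy W.
Proof.
move=> v0 cW.
pose l (t : R) : V := t *: v.
have cl : continuous l by move=> t; exact: scalel_continuous.
have ml : measurable_fun setT (l : measurableTypeR R -> borel).
  apply: (@measurability _ _ (measurableTypeR R) borel setT l (@open V)) => //.
  move=> _ [A oA <-]; rewrite setTI; apply: measurable_realfun.open_measurable.
  by move/continuousP: cl; exact.
have m01 : measurable (`[0, 1] : set (measurableTypeR R)) by exact: measurable_itv.
have [|mu mu_push] := finite_pushforward (m := mrestr lebesgue_measure m01) _ ml.
  by rewrite /= /mrestr setTI lebesgue_measure_itv/= lte_fin ltr01 ltry.
have muE (A : set borel) :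
    mu A = lebesgue_measure (l @^-1` A `&` `[0%R, 1%R]) by rewrite mu_push.
have cQ : compact (l @` `[0, 1]).
  apply: continuous_compact; last exact: segment_compact.
  exact: continuous_subspaceT.
have QC : l @^-1` (~` (l @` `[0, 1])) `&` `[0, 1] = set0.
  by rewrite -subset0 => t [/= nQ t01]; apply: nQ; exists t.
exists mu; split.
- rewrite muE preimage_setT setTI lebesgue_measure_itv/= lte_fin ltr01.
  by rewrite oppr0 adde0 => /eqP; rewrite eqe oner_eq0.
- by exists (l @` `[0, 1]) => //; rewrite muE QC measure0.
(* [t *: v] lies in the translate of [W] by [z] exactly when [t *: v - z] lies in [W]. *)
move=> z; have cT := cW (- z).
set T := [set t | W _] in cT.
have mlT : measurable (l @` T : set borel).
  apply: countable_measurable => [t|].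
    by apply: borel_measurable_closed; apply: accessible_closed_set1;
      exact/hausdorff_accessible/norm_hausdorff.
  exact: sub_countable (card_image_le _ _) cT.
exists (~` (l @` `[0, 1]) `|` l @` T); split.
- apply: measurableU => //; apply: borel_measurable_open; apply: closed_openC.
  by apply: compact_closed => //; exact: norm_hausdorff.
- rewrite muE preimage_setU setIUl QC set0U; apply: countable_lebesgue_measure0.
  apply: sub_countable cT; apply: subset_card_le => t [[s Ts /eqP]].
  rewrite -subr_eq0 -scalerBl scaler_eq0 subr_eq0 => /orP[/eqP <-//|/eqP//].
move=> _ [w Ww <-].
have [[t t01 wE]|] := pselect ((l @` `[0, 1]) (w + z)); last by left.
by right; exists t => //; rewrite /T/= -/(l t) wE addrK.
Qed.

End Line.

Unset Implicit Arguments.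

Theorem theorem5 (R : realType) (V : completeNormedModType R)
    (K X : set V) (Phi : R -> V -> V)
    (Vsep : separable V)
    (Kcone : order_cone K)
    (Xconv : p_convex K X)
    (Phi_flow : semiflow X Phi)
    (Phi_sop : strongly_order_preserving K X Phi)
    (Cdense : dense_in (convergent_points X Phi) (compact_orbit_points X Phi)) :
  prevalent_in (convergent_points X Phi) (compact_orbit_points X Phi).
Proof.
have [v Kv v0] := exists_positive Kcone.
apply: (shy_countable_lines v0) => z.
set S := [set t | _].
have SB t : S t -> compact_orbit_points X Phi (t *: v + z) by case.
have lt s t : s < t -> cone_lt K (s *: v + z) (t *: v + z).
  rewrite /cone_lt /cone_le opprD addrACA subrr addr0 -scalerBl => st; split.
    by apply: order_cone_scale => //; rewrite subr_ge0 ltW.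
  move=> /addIr/eqP; rewrite -subr_eq0 -scalerBl scaler_eq0 subr_eq0.
  by rewrite lt_eqF//= => /eqP.
apply: (countable_chain (Om := fun t => omega_limit X Phi (t *: v + z)) Vsep
  (order_cone_closed Kcone)) => [t [Bt nCt]|s m t Ss Sm St sm mt q p oq op].
  have [a [b [oa ob ab]]] := omega_limit_two_points Phi_flow Bt nCt.
  (* By antisymmetry [a - b] and [b - a] cannot both lie in [K]. *)
  have [Kab|] := pselect (K (a - b)); last by exists a, b.
  by exists b, a; split => // Kba; apply: ab; exact: cone_le_anti Kba Kab.
apply: (omega_limit_ordered Kcone Phi_flow Phi_sop Cdense _ (SB m Sm) _
  (lt _ _ sm) (lt _ _ mt)) => //.
- exact: (SB s Ss).1.
- exact: (SB t St).1.
Qed.
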